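(* Let $n\ge2$ be an integer, let $d\in\mathbb{Z}$, and let $P(x):=x^n+d$. Let $q\ge2$ be an integer and let $\mathcal{I}\subset\mathbb{R}$ be an interval of length at most $q^{1/n}$. Then the number $W$ of integers $x\in\mathcal{I}$ satisfying $P(x)\equiv0\pmod q$ satisfies $$W\le n\,\omega(q).$$
   Context: $\omega(q)$ denotes the number of distinct prime divisors of $q$. *)

(* Defs.v *)
From HB Require Import structures.
From mathcomp Require Export all_boot all_order all_algebra.
From mathcomp Require Export finmap.
From mathcomp Require Export all_classical all_reals all_analysis.
Set Implicit Arguments.
Unset Strict Implicit.
Unset Printing Implicit Defensive.
Import Order.TTheory GRing.Theory Num.Theory.
Local Open Scope ring_scope.

Definition omega (q : nat) : nat := size (primes q).

(* Elementary length of an interval: the difference of its endpoints, [0] when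
   the interval is empty and [+oo] when it is unbounded. *)
Definition itv_length (R : realType) (I : interval R) : \bar R :=
  if (I.1 < I.2 :> \bar R)%O then ((I.2 : \bar R) - (I.1 : \bar R))%E else 0%E.

Definition binom_poly (n : nat) (d : int) : {poly int} := 'X^n + d%:P.

Definition solutions (R : realType) (n : nat) (d : int) (q : nat)
    (I : interval R) : set int :=
  [set x : int | (x%:~R : R) \in I /\ ((binom_poly n d).[x] = 0 %[mod q])%Z]%classic.

(* Main.v *)
Require Import Defs.
From mathcomp Require Import finmap.
From mathcomp Require Import ring zify.
Set Implicit Arguments.
Unset Strict Implicit.
Unset Printing Implicit Defensive.
Import Order.TTheory GRing.Theory Num.Theory.
Local Open Scope ring_scope.

(** Two solutions satisfy x^n = y^n modulo q and |x - y|^n <= q, and only this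
    is used: a set X of integers with these two properties has at most
    n w elements, where w is the number of primes dividing q.

    One first reduces to X prime to q ([power_congruent_size]): a prime p
    that divides q and some element of X divides all of X, and dividing X by p
    preserves the hypotheses for a smaller q.

    Suppose then that X is prime to q and has more than n w elements. Let p^k be
    the exact power of p in q, with p odd. The elements of X occupy at most n
    classes modulo p^k ([odd_prime_class]), so w + 1 of them agree modulo p^k.
    Let V be the product of the differences of these s = w + 1 elements. It is
    divisible by p^k once per pair, and, with Q = q / p^k, by Q to the power
    of the sum of the floors of i / n for i < s. The second fact
    ([Vandermonde_dvd]) holds for the roots modulo Q of any monic polynomial of
    degree n: on the average a pair of roots shares a fraction of about 1 / n
    of the modulus. As each difference is at most q^(1/n) in absolute value,
    the slight shortfall from 1 / n is the only obstacle to a contradiction, and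
    the clustering modulo p^k compensates for it: [cluster_bound] gives
    p^(k w (n - 1)) <= Q^(n - 1), that is p^(k (w + 1)) <= q, which fails if
    p^k is the largest prime power dividing q, because then p^(k w) >= q.

    The prime 2 needs care, since there can be 2 n classes modulo 2^k, and only
    the modulus 2^(k - 1) is available ([even_prime_class]). But if
    p^(k (w + 1)) <= q for every odd p, then multiplying these inequalities
    shows that 2 divides q and that the geometric mean of the odd prime powers
    is at most the square root of 2^k, which makes up for the lost factor. *)

(** * Pigeonhole for residue classes *)

Lemma large_fibre (A B : eqType) (f : A -> B) (vals : seq B) (t : nat)
    (X : seq A) :
  {in X, forall x, f x \in vals} -> (size vals * t < size X)%N ->
  exists v, (t < size [seq x <- X | f x == v])%N.
Proof.
elim: vals X => [|v vals IH] X fX ltX.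
  by case: X fX ltX => // x X /(_ x); rewrite mem_head => /(_ isT).
have [ltv|lev] := ltnP t (size [seq x <- X | f x == v]); first by exists v.
have [x|/=|w ltw] := IH [seq x <- X | f x != v].
- by rewrite mem_filter => /andP[/negPf fxv /fX]; rewrite inE fxv.
- have := count_predC (fun x => f x == v) X.
  move: lev ltX; rewrite !size_filter /= mulSn.
  rewrite (eq_count (a1 := predC _) (a2 := fun x => f x != v)) //; lia.
exists w; apply: leq_trans ltw _; rewrite !size_filter count_filter.
by rewrite sub_count // => x /andP[].
Qed.

(** Pigeonhole on the residue of (x - x0) / M modulo N, where x0 is any fixed
    member of S. *)
Lemma refine_class (M N t : nat) (S : seq int) :
  (0 < M)%N -> (0 < N)%N ->
  {in S &, forall x y, (M %| x - y)%Z} -> (N * t < size S)%N ->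
  exists S', [/\ subseq S' S, (t < size S')%N
    & {in S' &, forall x y, ((M * N)%:Z %| x - y)%Z}].
Proof.
case: S => // x0 S Mgt Ngt cong ltS.
pose f x := (((x - x0) %/ M)%Z %% N)%Z.
have fvals x : f x \in [seq Posz i | i <- iota 0 N].
  have Nz : (N%:Z != 0) by lia.
  have := modz_ge0 ((x - x0) %/ M)%Z Nz.
  have := ltz_pmod ((x - x0) %/ M)%Z (d := N) ltac:(lia).
  rewrite -/(f x); case: (f x) => // k kN _.
  by rewrite mem_map ?mem_iota //= => u v [].
have [||v ltv] := @large_fibre _ _ f [seq Posz i | i <- iota 0 N] t (x0 :: S).
- by move=> x _.
- by rewrite size_map size_iota.
exists [seq x <- x0 :: S | f x == v]; split=> //; first exact: filter_subseq.
move=> x y; rewrite !mem_filter => /andP[/eqP fx Sx] /andP[/eqP fy Sy].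
have S0 := mem_head x0 S.
have -> : x - y = (((x - x0) %/ M)%Z - ((y - x0) %/ M)%Z) * M.
  by rewrite mulrBl !divzK ?cong //; ring.
rewrite PoszM mulrC dvdz_mul //.
by rewrite -eqz_mod_dvd -/(f x) -/(f y) fx fy.
Qed.

(** * Lifting the exponent *)

Lemma prime_dvdz_X (p : nat) (x : int) (m : nat) :
  prime p -> (p %| x ^+ m)%Z -> (p %| x)%Z.
Proof. by move=> pp; rewrite !dvdzE abszX /= Euclid_dvdX // => /andP[]. Qed.

Lemma dvdz_congr (d a b : int) : (d %| a - b)%Z -> (d %| a)%Z = (d %| b)%Z.
Proof. by move=> dab; rewrite -(rpredDl b dab) subrK. Qed.

Lemma dvdz_subXX (d x y : int) (m : nat) :
  (d %| x - y)%Z -> (d %| x ^+ m - y ^+ m)%Z.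
Proof. by move=> dxy; rewrite subrXX dvdz_mulr. Qed.

Lemma geometric_sum_mod (x y : int) (m : nat) :
  (x - y %| (\sum_(i < m) x ^+ (m.-1 - i) * y ^+ i) - m%:R * y ^+ m.-1)%Z.
Proof.
have -> : m%:R * y ^+ m.-1 = \sum_(i < m) y ^+ (m.-1 - i) * y ^+ i.
  rewrite (eq_bigr (fun=> y ^+ m.-1)).
    by rewrite sumr_const card_ord mulr_natl.
  by move=> i _; rewrite -exprD subnK //; have := ltn_ord i; lia.
rewrite -sumrB; apply: rpred_sum => i _.
by rewrite -mulrBl dvdz_mulr // dvdz_subXX.
Qed.

(** Pairing the index i with m - 1 - i turns each term of the difference into a
    product (x^r - y^r) (x^i - y^i), both factors of which x - y divides. The
    gain over [geometric_sum_mod] is a second factor x - y, which is what is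
    needed to see that p^2 does not divide the sum when m = p is odd and
    x = y modulo p. *)
Lemma geometric_sum_mod_sqr (x y : int) (m : nat) :
  ((x - y) ^+ 2 %| (\sum_(i < m) x ^+ (m.-1 - i) * y ^+ i) *+ 2
     - m%:R * (x ^+ m.-1 + y ^+ m.-1))%Z.
Proof.
have E : \sum_(i < m) x ^+ (m.-1 - i) * y ^+ i
  = \sum_(i < m) x ^+ i * y ^+ (m.-1 - i).
  rewrite (reindex_inj rev_ord_inj) /=; apply: eq_bigr => i _.
  by congr (x ^+ _ * y ^+ _); have := ltn_ord i; lia.
have -> : m%:R * (x ^+ m.-1 + y ^+ m.-1) = \sum_(i < m) (x ^+ m.-1 + y ^+ m.-1).
  by rewrite sumr_const card_ord mulr_natl.
rewrite mulr2n {2}E -big_split /= -sumrB.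
apply: rpred_sum => i _.
have -> : m.-1 = ((m.-1 - i) + i)%N by have := ltn_ord i; lia.
rewrite addnK !exprD.
set b := x ^+ i; set a := x ^+ _; set c := y ^+ (_ - _); set d := y ^+ i.
have -> : a * d + b * c - (a * b + c * d) = - ((a - c) * (b - d)) by ring.
rewrite rpredN expr2; apply: dvdz_mul; exact: dvdz_subXX.
Qed.

Lemma prime_pow_dvdzMl (p k e : nat) (a b : int) : prime p ->
  ((p ^ k)%N %| a * b)%Z -> ~~ ((p ^ e.+1)%N %| b)%Z -> ((p ^ (k - e))%N %| a)%Z.
Proof.
move=> pp; have [->|a0] := eqVneq a 0; first by rewrite dvdz0.
have [->|b0] := eqVneq b 0; first by rewrite dvdz0.
rewrite !dvdzE !abszM /= !pfactor_dvdn ?muln_gt0 ?absz_gt0 ?a0 ?b0 //.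
rewrite lognM ?absz_gt0 //; lia.
Qed.

Lemma dvdz_cancel_coprime_exp (p k m : nat) (x y : int) : prime p ->
  ~~ (p %| m)%N -> ~~ (p %| x)%Z -> (p %| x - y)%Z ->
  ((p ^ k)%N %| x ^+ m - y ^+ m)%Z -> ((p ^ k)%N %| x - y)%Z.
Proof.
move=> pp pm px pxy; rewrite subrXX => /(prime_pow_dvdzMl (e := 0) pp).
rewrite subn0 expn1; apply.
apply: contra px; rewrite (dvdz_congr (dvdz_trans pxy (geometric_sum_mod x y m))).
have copm : coprimez p m%:Z by rewrite coprimezE prime_coprime.
rewrite natz Gauss_dvdzr // => /(prime_dvdz_X pp) py.
by rewrite (dvdz_congr pxy).
Qed.

(** Raising to the power p increases the p-adic valuation of x - y by exactly
    one: the cofactor is divisible by p but not by p^2. For p = 2 the cofactor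
    is x + y, and x = y modulo 4 is needed to exclude a second factor 2. *)
Lemma dvdz_cancel_prime_exp (p k : nat) (x y : int) : prime p ->
  ~~ (p %| x)%Z -> (p %| x - y)%Z -> (p = 2 -> (4 %| x - y)%Z) ->
  ((p ^ k)%N %| x ^+ p - y ^+ p)%Z -> ((p ^ k.-1)%N %| x - y)%Z.
Proof.
move=> pp px pxy p4; rewrite subrXX => /(prime_pow_dvdzMl (e := 1) pp).
rewrite subn1; apply; apply: contra px => pT.
rewrite (dvdz_congr pxy).
have [p2|podd] := even_prime pp.
  move: pT; rewrite p2 in pxy p4 *.
  rewrite !big_ord_recr big_ord0 /= => pT; have {}p4 := p4 erefl; move: pT.
  rewrite add0r !expr1 !expr0 mulr1 mul1r; move: p4.
  move=> /dvdzP[u xu] /dvdzP[v xv]; apply/dvdzP; exists (v - u); lia.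
have copm : coprimez p 2%:Z by rewrite coprimezE /= coprimen2.
apply: (prime_dvdz_X (m := p.-1) pp); rewrite -(Gauss_dvdzr _ copm).
have pp0 : p%:Z != 0 by have := prime_gt0 pp; lia.
have : (p %| x ^+ p.-1 + y ^+ p.-1)%Z.
  have := geometric_sum_mod_sqr x y p; rewrite natz => H.
  rewrite -(dvdz_mul2r pp0) -expr2 mulrC.
  rewrite -(dvdz_congr (dvdz_trans (dvdz_exp2r 2 pxy) H)).
  by rewrite mulr2n rpredD.
rewrite (dvdz_congr (b := 2%:Z * y ^+ p.-1)) //.
have -> : x ^+ p.-1 + y ^+ p.-1 - 2%:Z * y ^+ p.-1 = x ^+ p.-1 - y ^+ p.-1.
  by ring.
exact: dvdz_subXX.
Qed.

(** Lifting the exponent: passing from x - y to x^n - y^n gains no more than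
    the valuation of n. One factor p of n is peeled off at a time. *)
Lemma dvdz_cancel_exp (p k n : nat) (x y : int) : prime p -> (0 < n)%N ->
  ~~ (p %| x)%Z -> (p %| x - y)%Z -> (p = 2 -> (4 %| x - y)%Z) ->
  ((p ^ k)%N %| x ^+ n - y ^+ n)%Z -> ((p ^ (k - logn p n))%N %| x - y)%Z.
Proof.
move=> pp n0; have [m pm nE] := pfactor_coprime pp n0.
set a := logn p n in nE *; clearbody a; rewrite {n n0}nE.
have {}pm : ~~ (p %| m)%N by rewrite -prime_coprime.
elim: a x y k => [|a IH] x y k px pxy p4.
  by rewrite expn0 muln1 subn0; apply: dvdz_cancel_coprime_exp.
rewrite expnS mulnCA (exprM x) (exprM y) => /IH H.
rewrite subnS; apply: dvdz_cancel_prime_exp => //; apply: H.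
- by apply: contra px; apply: prime_dvdz_X.
- exact: dvdz_subXX.
- by move=> /p4 ?; apply: dvdz_subXX.
Qed.

(** * Clusters of solutions modulo a prime power *)

(** Write n = p^a m with m prime to p. In the field with p elements the map
    u |-> u^(p^a) is injective, so the x^m also agree and the residues of X
    are roots of a polynomial of degree m: there are at most m = n / p^a
    classes. *)
Lemma few_power_residues (p n t : nat) (X : seq int) : prime p -> (0 < n)%N ->
  {in X &, forall x y, (p %| x ^+ n - y ^+ n)%Z} -> (n * t < size X)%N ->
  exists S, [/\ subseq S X, (p ^ logn p n * t < size S)%N
    & {in S &, forall x y, (p %| x - y)%Z}].
Proof.
case: X => // x0 X pp n0 cong ltX.
have [m pm nE] := pfactor_coprime pp n0.
have m0 : (0 < m)%N by rewrite lt0n; apply: contraTneq n0 => m0; rewrite nE m0.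
pose f (x : int) : 'F_p := x%:~R.
have dvdF (x : int) : (p %| x)%Z = (f x == 0) := dvdz_pcharf (pchar_Fp pp) x.
have [||v ltv] := @large_fibre _ _ f (undup (map f (x0 :: X)))
    (p ^ logn p n * t) (x0 :: X).
- by move=> x xX; rewrite mem_undup map_f.
- apply: leq_ltn_trans ltX; rewrite [X in (_ <= X * _)%N]nE -mulnA leq_mul2r.
  apply/orP; right; rewrite -ltnS -(size_XnsubC (f x0 ^+ m) m0).
  apply: max_poly_roots; last exact: undup_uniq.
    by rewrite -size_poly_gt0 size_XnsubC.
  apply/allP => v; rewrite mem_undup => /mapP[x xX ->].
  rewrite rootE !hornerE.
  have := cong x x0 xX (mem_head _ _); rewrite dvdF /f rmorphB !rmorphXn /=.
  rewrite {1 2}nE !exprM -/(f x) -/(f x0).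
  set u := f x ^+ m; set w := f x0 ^+ m.
  have pnat : [pchar 'F_p].-nat (p ^ logn p n)%N.
    by rewrite pnatX (eq_pnat _ (pcharf_eq (pchar_Fp pp))) pnat_id.
  have := exprDn_pchar (u - w) w pnat; rewrite subrK => ->.
  by rewrite addrK expf_eq0 => /andP[].
exists [seq x <- x0 :: X | f x == v]; split=> //; first exact: filter_subseq.
move=> x y; rewrite !mem_filter => /andP[/eqP fx _] /andP[/eqP fy _].
by rewrite dvdF /f rmorphB /= -/(f x) -/(f y) fx fy subrr.
Qed.

Lemma dvdz_pow_le (p j k : nat) (x : int) :
  (j <= k)%N -> ((p ^ k)%N %| x)%Z -> ((p ^ j)%N %| x)%Z.
Proof. by move=> jk; apply: dvdz_trans; rewrite dvdzE /= dvdn_exp2l. Qed.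

(** With p^a the p-part of n, the at most n / p^a residue classes modulo p
    consist, by lifting the exponent, of numbers that agree modulo p^(k - a),
    and each such class splits into at most p^a classes modulo p^k. Altogether
    the solutions lie in at most n classes modulo p^k. *)
Lemma odd_prime_class (p k n t : nat) (X : seq int) :
  prime p -> odd p -> (0 < n)%N -> {in X, forall x, ~~ (p %| x)%Z} ->
  {in X &, forall x y, ((p ^ k)%N %| x ^+ n - y ^+ n)%Z} ->
  (n * t < size X)%N ->
  exists S, [/\ subseq S X, (t < size S)%N
    & {in S &, forall x y, ((p ^ k)%N %| x - y)%Z}].
Proof.
move=> pp podd n0 pX cong ltX; case: k cong => [|k] cong.
  by exists X; split=> //; apply: leq_ltn_trans ltX; rewrite leq_pmull.
have cong1 : {in X &, forall x y, (p %| x ^+ n - y ^+ n)%Z}.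
  move=> x y xX yX.
  have := dvdz_pow_le (p := p) (isT : 1 <= k.+1)%N (cong x y xX yX).
  by rewrite expn1.
have [S [SX ltS congS]] := few_power_residues pp n0 cong1 ltX.
have subX := mem_subseq SX.
have pgt j : (0 < p ^ j)%N by rewrite expn_gt0 prime_gt0.
have liftS : {in S &, forall x y, ((p ^ (k.+1 - logn p n))%N %| x - y)%Z}.
  move=> x y xS yS.
  apply: (dvdz_cancel_exp pp n0 (pX _ (subX _ xS))); first exact: congS.
    by move=> p2; rewrite p2 in podd.
  by apply: cong; apply: subX.
have [S' [S'S ltS' congS']] := refine_class (pgt _) (pgt _) liftS ltS.
exists S'; split=> //; first exact: subseq_trans SX.
move=> x y xS yS; apply: dvdz_pow_le (_ : k.+1 <= _)%N _; last first.
  by have := congS' x y xS yS; rewrite -expnD; apply.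
lia.
Qed.

(** Modulo 2^k there can be 2n classes, as x^2 = 1 modulo 8 shows. Giving up
    one factor 2 restores the bound n: with 2^a the 2-part of n and a > 0, the
    two odd classes modulo 4 consist of numbers agreeing modulo 2^(k - a), and
    each needs only 2^(a - 1) subclasses to reach the modulus 2^(k - 1).
    The minimum with 2 records that the modulus 4 comes for free, which matters
    for k at most 2. *)
Lemma even_prime_class (k n t : nat) (X : seq int) :
  (1 < n)%N -> {in X, forall x, ~~ (2 %| x)%Z} ->
  {in X &, forall x y, ((2 ^ k)%N %| x ^+ n - y ^+ n)%Z} ->
  (n * t < size X)%N ->
  exists S, [/\ subseq S X, (t < size S)%N
    & {in S &, forall x y, ((2 ^ maxn k.-1 (minn k 2))%N %| x - y)%Z}].
Proof.
move=> n1 oddX cong ltX.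
have n0 : (0 < n)%N by lia.
have odd2 : {in X &, forall x y, (2%N %| x - y)%Z}.
  by move=> x y /oddX xX /oddX yX; lia.
have [a0|a0] := posnP (logn 2 n).
  exists X; split=> //; first by apply: leq_ltn_trans ltX; rewrite leq_pmull.
  move=> x y xX yX; apply: (@dvdz_pow_le _ _ k); first lia.
  apply: (dvdz_cancel_coprime_exp (m := n)) => //; try exact: oddX.
  - apply/negP => n2; have := pfactor_dvdn 1 (isT : prime 2) n0.
    by rewrite expn1 n2; lia.
  - exact: odd2.
  exact: cong.
have nge : (2 * (2 ^ (logn 2 n).-1) <= n)%N.
  rewrite -expnS prednK //; apply: dvdn_leq => //; exact: pfactor_dvdnn.
have ltX2 : (2 * (2 ^ (logn 2 n).-1 * t) < size X)%N.
  by apply: leq_ltn_trans ltX; rewrite mulnA leq_mul2r nge orbT.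
have [S [SX ltS congS]] := @refine_class 2 2 _ _ isT isT odd2 ltX2.
have subX := mem_subseq SX.
have gt0 j : (0 < 2 ^ j)%N by rewrite expn_gt0.
have liftS : {in S &, forall x y, ((2 ^ (k - logn 2 n))%N %| x - y)%Z}.
  move=> x y xS yS.
  apply: (dvdz_cancel_exp (p := 2) isT n0 (oddX _ (subX _ xS))).
  - by apply: odd2; apply: subX.
  - by move=> _; apply: congS.
  by apply: cong; apply: subX.
have [S' [S'S ltS' congS']] := refine_class (gt0 _) (gt0 _) liftS ltS.
exists S'; split=> //; first exact: subseq_trans SX.
move=> x y xS yS; have subS := mem_subseq S'S.
have [lek|gtk] := leqP (maxn k.-1 (minn k 2)) 2.
  by apply: dvdz_pow_le lek _; apply: congS; apply: subS.
apply: (@dvdz_pow_le _ _ (k - logn 2 n + (logn 2 n).-1)); first lia.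
by rewrite expnD; apply: congS'.
Qed.

(** * The Vandermonde determinant of the solutions *)

(** In the Vandermonde determinant the powers X^i may be replaced by the monic
    polynomials X^(i mod n) (X^n - c)^(i / n) of the same degrees; the row of
    index i is then divisible by q^(i / n). The resulting exponent is what
    one would get if the x were spread evenly over n residue classes. *)
Lemma Vandermonde_dvd (s n q : nat) (c : int) (x : 'rV[int]_s) : (0 < n)%N ->
  (forall i, (q %| x 0%R i ^+ n - c)%Z) ->
  ((q ^ (\sum_(i < s) i %/ n))%N %|
     \prod_(i < s) \prod_(j < s | (i < j)%N) (x 0%R j - x 0%R i))%Z.
Proof.
move=> n0 root.
(* The polynomial of degree i used in place of X^i. *)
pose P (i : 'I_s) : {poly int} := 'X^(i %% n) * ('X^n - c%:P) ^+ (i %/ n).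
have Pm i : P i \is monic.
  by rewrite monicMl ?monicXn // monic_exp // monicXnsubC.
have sP i : size (P i) = i.+1.
  rewrite size_monicM ?monicXn ?monic_neq0 ?monic_exp ?monicXnsubC //.
  rewrite size_polyXn -[size (('X^n - _) ^+ _)]prednK; last first.
    by rewrite size_poly_gt0 monic_neq0 // monic_exp // monicXnsubC.
  rewrite size_exp size_XnsubC //= addnS /= [in RHS](divn_eq i n); congr _.+1.
  by rewrite addnC mulnC.
pose T : 'M[int]_s := \matrix_(i, l) (P i)`_l.
have detT : \det T = 1.
  rewrite det_trig; last first.
    apply/is_trig_mxP => i j ij; rewrite mxE nth_default // sP; exact: ij.
  rewrite big1 // => i _; rewrite mxE.
  by have /monicP := Pm i; rewrite lead_coefE sP.
pose B : 'M[int]_s := \matrix_(i, j) ((P i).[x 0%R j] %/ (q ^ (i %/ n))%N)%Z.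
have E : T *m Vandermonde s x = diag_mx (\row_i (q ^ (i %/ n))%N%:Z) *m B.
  apply/matrixP => i j; rewrite mul_diag_mx !mxE mulrC divzK.
    rewrite (@horner_coef_wide _ s); last by rewrite sP.
    by apply: eq_bigr => l _; rewrite !mxE.
  rewrite !hornerE dvdz_mull //.
  by rewrite -natz natrX natz dvdz_exp2r.
rewrite -det_Vandermonde -[\det _]mul1r -detT -det_mulmx E det_mulmx det_diag.
rewrite (eq_bigr (fun i : 'I_s => (q ^ (i %/ n))%N%:Z)).
  by rewrite -(big_morph Posz PoszM (erefl 1%:Z)) -expn_sum dvdz_mulr.
by move=> i _; rewrite mxE.
Qed.

(** The remainder term is nonnegative, so that the sum is at least
    s (s - n) / (2 n), the value that an even spread over n classes would give. *)
Lemma sum_divn (s n : nat) : (0 < n)%N ->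
  (2 * n * (\sum_(i < s) i %/ n) + s * n = s ^ 2 + s %% n * (n - s %% n))%N.
Proof.
move=> n0; elim: s => [|s IH]; first by rewrite big_ord0 mod0n muln0 !mul0n.
rewrite big_ord_recr /=.
have sE := divn_eq s n; have ltr := ltn_pmod s n0.
have rE : (s.+1 %% n = (s %% n).+1 %% n)%N by rewrite -addn1 -modnDml addn1.
move: sE ltr rE IH; move: (\sum_(i < s) _)%N (s %/ n)%N (s %% n)%N => A b r.
have [lt|ge] := ltnP r.+1 n => sE ltr ->.
  rewrite modn_small //; have [e nE] : exists e, n = (r.+1 + e)%N.
    by exists (n - r.+1)%N; lia.
  have -> : (n - r.+1 = e)%N by lia.
  have -> : (n - r = e.+1)%N by lia.
  rewrite nE -!mulnn in sE *; lia.
have nE : n = r.+1 by lia.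
rewrite nE modnn subSnn -!mulnn in sE *; lia.
Qed.

Lemma card_ltn_pairs (s : nat) :
  #|[pred ij : 'I_s * 'I_s | (ij.1 < ij.2)%N]| = 'C(s, 2).
Proof.
rewrite -sum1_card -bin2_sum big_mkord.
rewrite -(pair_big_dep xpredT (fun i j : 'I_s => (i < j)%N) (fun _ _ => 1%N)) /=.
rewrite (exchange_big_dep xpredT) //=; apply: eq_bigr => j _.
by rewrite -(big_ord_widen s (fun=> 1%N) (ltnW (ltn_ord j))) sum1_card card_ord.
Qed.

(** The product of the differences of S is divisible by K once for each pair
    and, independently, by the power of Q from [Vandermonde_dvd]; its n-th power
    is at most (P Q) to the number of pairs. Comparing the two gives an
    inequality from which the size of the interval has disappeared. *)
Lemma cluster_bound (n t K P Q : nat) (S : seq int) :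
  (0 < n)%N -> (0 < P)%N -> (0 < Q)%N -> coprime K Q ->
  uniq S -> size S = t.+1 ->
  {in S &, forall x y, (K %| x - y)%Z} ->
  {in S &, forall x y, (Q %| x ^+ n - y ^+ n)%Z} ->
  {in S &, forall x y, (`|x - y| ^ n <= P * Q)%N} ->
  (K ^ (n * t) <= P ^ t * Q ^ n.-1)%N.
Proof.
move=> n0 P0 Q0 KQ uS sS KS QS dS; set s := t.+1 in sS.
have inS (i : 'I_s) : S`_i \in S by rewrite mem_nth // sS.
pose x : 'rV[int]_s := \row_i S`_i.
pose V := \prod_(i < s) \prod_(j < s | (i < j)%N) (x 0%R j - x 0%R i).
have VE : V = \prod_(ij : 'I_s * 'I_s | (ij.1 < ij.2)%N) (S`_ij.2 - S`_ij.1).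
  rewrite /V pair_big_dep /=; apply: eq_bigr => ij _; by rewrite !mxE.
have absV : `|V|%N =
  (\prod_(ij : 'I_s * 'I_s | (ij.1 < ij.2)%N) `|(S`_ij.2 - S`_ij.1)%R|)%N.
  by rewrite VE (big_morph _ abszM (erefl : `|1|%N = 1%N)).
set N := 'C(s, 2).
have cst m : (\prod_(ij : 'I_s * 'I_s | (ij.1 < ij.2)%N) m = m ^ N)%N.
  by rewrite prod_nat_const card_ltn_pairs.
have KV : (K ^ N %| `|V|)%N.
  rewrite absV -cst; apply: (big_ind2 (fun a b => a %| b)%N) => //.
    by move=> *; apply: dvdn_mul.
  by move=> ij _; have := KS _ _ (inS ij.2) (inS ij.1); rewrite dvdzE.
have QV : (Q ^ (\sum_(i < s) i %/ n) %| `|V|)%N.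
  have := @Vandermonde_dvd s n Q (S`_0 ^+ n) x n0; rewrite -/V dvdzE /=; apply.
  by move=> i; rewrite mxE; apply: QS => //; apply: (inS ord0).
have Vgt : (0 < `|V|)%N.
  rewrite absV prodn_cond_gt0 // => ij ltij.
  by rewrite absz_gt0 subr_eq0 nth_uniq ?sS // gtn_eqF.
have Vle : (`|V| ^ n <= (P * Q) ^ N)%N.
  rewrite absV (big_morph (fun m => m ^ n)%N (fun a b => expnMn a b n) (exp1n n)).
  rewrite -cst; apply: (big_ind2 leq) => // [*|ij _]; first exact: leq_mul.
  exact: dS (inS _) (inS _).
set Sg := (\sum_(i < s) i %/ n)%N in QV.
have KQV : (K ^ N * Q ^ Sg <= `|V|)%N.
  by rewrite dvdn_leq // Gauss_dvd ?KV // coprimeXl // coprimeXr.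
(* The exponents are doubled so that twice the number of pairs, t s, and
   [sum_divn] can be used. *)
have {KQV Vle} main : (K ^ (n * t * s) * Q ^ (2 * n * Sg) <= (P * Q) ^ (t * s))%N.
  have NE : (N * 2 = t * s)%N by have := mul_bin_diag s 1; rewrite bin1 /N /s /=; lia.
  have : ((K ^ N * Q ^ Sg) ^ (n * 2) <= (P * Q) ^ (N * 2))%N.
    rewrite !(expnM _ _ 2) leq_exp2r //; apply: leq_trans Vle.
    by rewrite leq_exp2r.
  rewrite expnMn -!expnM NE.
  by congr (K ^ _ * Q ^ _ <= _)%N; lia.
(* Multiplying by Q^(s n) avoids the subtraction in the lower bound
   s (s - n) for 2 n times the sum of the i / n. *)
have {main} : (K ^ (n * t * s) * Q ^ (s ^ 2) <= (P ^ t * Q ^ n.-1) ^ s * Q ^ (s ^ 2))%N.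
  apply: (@leq_trans (K ^ (n * t * s) * Q ^ (2 * n * Sg + s * n))%N).
    by rewrite leq_mul2l leq_pexp2l ?orbT // /Sg sum_divn // leq_addr.
  rewrite expnD mulnA; apply: leq_trans (leq_mul main (leqnn _)) _.
  rewrite !expnMn -!expnM -!mulnA -!expnD.
  rewrite leq_mul2l leq_pexp2l ?orbT // /s.
  by case: (n) n0 => // n' _; rewrite -mulnn /=; lia.
by rewrite leq_pmul2r ?expn_gt0 ?Q0 // expnM leq_exp2r.
Qed.

(** * Counting solutions *)

Lemma prime_pow_factor (q p : nat) : p \in primes q ->
  exists Q, [/\ q = (p ^ logn p q * Q)%N, coprime p Q & (0 < Q)%N].
Proof.
rewrite mem_primes => /and3P[pp q0 pq].
have [Q cop qE] := pfactor_coprime pp q0.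
exists Q; split=> //; first by rewrite mulnC.
by rewrite lt0n; apply: contraTneq q0 => Q0; rewrite qE Q0.
Qed.

Lemma prod_pfactors (q : nat) : (0 < q)%N ->
  (\prod_(p <- primes q) p ^ logn p q = q)%N.
Proof.
by move=> q0; rewrite [RHS]prod_prime_decomp // prime_decompE big_map.
Qed.

(** Suppose that X has more than n w elements, w being the number of primes
    dividing q. Each prime p dividing q yields w + 1 elements of X clustered
    modulo K, where K is p^k for odd p and essentially 2^(k - 1) for p = 2,
    and [cluster_bound] applies to them. An odd p with
    q < p^(k (w + 1)) gives a contradiction; if there is none, 2^k is so large
    that p = 2 gives one, the lost factor 2 notwithstanding. *)
Lemma coprime_power_congruent_size (n q : nat) (X : seq int) : (1 < n)%N -> (1 < q)%N ->
  uniq X -> {in primes q & X, forall p x, ~~ (p%:Z %| x)%Z} ->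
  {in X &, forall x y, (q %| x ^+ n - y ^+ n)%Z} ->
  {in X &, forall x y, (`|x - y| ^ n <= q)%N} ->
  (size X <= n * size (primes q))%N.
Proof.
move=> n1 q1 uX coX congX diamX; rewrite leqNgt; apply/negP.
set w := size (primes q) => ltX.
have n0 : (0 < n)%N by lia.
have q0 : (0 < q)%N by lia.
have bound p e Q S : prime p -> q = (p ^ logn p q * Q)%N -> coprime p Q ->
    (0 < Q)%N -> subseq S X -> (w < size S)%N ->
    {in S &, forall x y, ((p ^ e)%N %| x - y)%Z} ->
    (p ^ (e * n * w) <= p ^ (logn p q * w) * Q ^ n.-1)%N.
  move=> pp qE cop Q0 SX ltS congS.
  have subS : {subset take w.+1 S <= S} by move=> x; apply: mem_take.
  have subX : {subset take w.+1 S <= X}.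
    by move=> x /subS; apply: mem_subseq SX x.
  rewrite (expnM p (logn p q)) -mulnA (expnM p e).
  apply: (@cluster_bound n w _ _ Q (take w.+1 S)) => //.
  - by rewrite coprimeXl.
  - by rewrite take_uniq // (subseq_uniq SX).
  - by rewrite size_takel.
  - by move=> x y /subS xS /subS yS; apply: congS.
  - move=> x y /subX xX /subX yX; apply: dvdz_trans (congX x y xX yX).
    by rewrite qE dvdzE /= dvdn_mull.
  - by move=> x y /subX xX /subX yX; rewrite -qE; apply: diamX.
have congp p : {in X &, forall x y, ((p ^ logn p q)%N %| x ^+ n - y ^+ n)%Z}.
  move=> x y xX yX; apply: dvdz_trans (congX x y xX yX).
  by rewrite dvdzE /= pfactor_dvdnn.
(* An odd prime power p^k with q < p^(k (w + 1)) is large enough for K. *)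
have [/hasP[p pq /andP[podd big]]|/hasPn small] :=
  boolP (has (fun p => odd p && (q < p ^ (logn p q * w.+1))%N) (primes q)).
  have pp : prime p by move: pq; rewrite mem_primes => /and3P[].
  have [Q [qE cop Q0]] := prime_pow_factor pq.
  have coXp : {in X, forall x, ~~ (p %| x)%Z} by move=> x; apply: coX.
  have [S [SX ltS congS]] := odd_prime_class pp podd n0 coXp (congp p) ltX.
  have := bound p _ Q S pp qE cop Q0 SX ltS congS.
  have -> : (logn p q * n * w = logn p q * w + logn p q * w * n.-1)%N.
    by case: (n) n0 => // n' _ /=; ring.
  rewrite expnD leq_pmul2l ?expn_gt0 ?prime_gt0 // expnM leq_exp2r; last by lia.
  move: big; rewrite {1}qE mulnS expnD ltn_pmul2l ?expn_gt0 ?prime_gt0 //; lia.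
(* Otherwise the odd prime powers are all small; 2^(k m) is then at
   least the square of their product Q, m being their number. *)
pose odds := [seq p <- primes q | odd p].
pose Q := (\prod_(p <- odds) p ^ logn p q)%N.
have oddsP p : p \in odds -> [/\ odd p, prime p, (0 < logn p q)%N
    & (p ^ (logn p q * w.+1) <= q)%N].
  rewrite mem_filter logn_gt0 => /andP[podd pq]; split=> //.
    by move: pq; rewrite mem_primes => /and3P[].
  by have := small p pq; rewrite podd /= -leqNgt.
have Qle : (Q ^ w.+1 <= q ^ size odds)%N.
  rewrite /Q; elim: (odds) oddsP => [|p ps IH] psP.
    by rewrite big_nil exp1n expn0.
  rewrite big_cons expnMn -expnM [X in (_ <= X)%N]expnS leq_mul //.
    by have [] := psP p (mem_head _ _).
  by apply: IH => p' p'ps; apply: psP; rewrite inE p'ps orbT.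
have Qge : (3 ^ size odds <= Q)%N.
  rewrite /Q; elim: (odds) oddsP => [|p ps IH] psP.
    by rewrite big_nil.
  rewrite big_cons expnS leq_mul //; last first.
    by apply: IH => p' p'ps; apply: psP; rewrite inE p'ps orbT.
  have [podd pp k0 _] := psP p (mem_head _ _).
  apply: (@leq_trans (p ^ 1)); last by rewrite leq_pexp2l // prime_gt0.
  by rewrite expn1 ltn_neqAle prime_gt1 // andbT; apply: contraTneq podd => <-.
have w0 : (0 < w)%N.
  rewrite /w; have : pdiv q \in primes q by rewrite mem_primes pdiv_prime ?q0 ?pdiv_dvd.
  by case: (primes q).
have evenE : [seq p <- primes q | ~~ odd p] = [seq p <- primes q | p == 2].
  apply: eq_in_filter => p; rewrite mem_primes => /and3P[pp _ _].
  have [->|podd] := even_prime pp; rewrite ?podd //.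
  by apply/esym/eqP => p2; rewrite p2 in podd.
have wE : w = (size odds + size [seq p <- primes q | p == 2])%N.
  by rewrite -evenE !size_filter count_predC.
have qE : q = (Q * \prod_(p <- [seq p <- primes q | p == 2]) p ^ logn p q)%N.
  by rewrite -evenE /Q !big_filter -{1}(prod_pfactors q0) (bigID odd).
have [q2|nq2] := boolP (2%N \in primes q); last first.
  have E : [seq p <- primes q | p == 2] = [::].
    by apply/eqP; rewrite -[_ == _]negbK -has_filter has_pred1.
  move: Qle; rewrite qE wE E big_nil /= muln1 addn0 leq_exp2l ?ltnn //.
  by move: q1; rewrite qE E big_nil muln1.
have E := filter_pred1_uniq (primes_uniq q) q2.
move: wE qE; rewrite E big_seq1 /= addn1 => wE qE.
have cop : coprime 2 Q.
  rewrite coprime2n /Q big_seq.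
  apply: (big_ind odd) => // [a b oa ob|p /oddsP[podd _ _ _]].
    by rewrite oddM oa.
  by rewrite oddX podd orbT.
have Q0 : (0 < Q)%N by rewrite lt0n; apply: contraTneq q0 => Q0; rewrite qE Q0.
set k := logn 2 q in qE.
have k0 : (0 < k)%N by rewrite /k logn_gt0.
have {}qE : q = (2 ^ k * Q)%N by rewrite qE mulnC.
have coX2 : {in X, forall x, ~~ (2 %| x)%Z} by move=> x; apply: coX.
have [S [SX ltS congS]] := even_prime_class n1 coX2 (congp 2) ltX.
have := bound 2 _ Q S isT qE cop Q0 SX ltS congS.
rewrite -/k; set e := maxn _ _; set m := size odds in Qge Qle wE *.
have Qsqr : (Q ^ 2 <= 2 ^ (k * m))%N.
  have : (Q ^ 2 * Q ^ m <= 2 ^ (k * m) * Q ^ m)%N.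
    by rewrite -expnD expnM -expnMn -qE; move: Qle; rewrite wE.
  by rewrite leq_pmul2r // expn_gt0 Q0.
(* 9^m <= Q^2 <= 2^(k m) with m > 0 forces 2^k >= 9: the lost factor 2 is
   then small compared to 2^k. *)
have k_ge4 : (0 < m)%N -> (3 < k)%N.
  move=> m0; have : (3 ^ 2 <= 2 ^ k)%N.
    rewrite -(@leq_exp2r _ _ m) // -expnM -expnM mulnC expnM.
    by apply: leq_trans Qsqr; rewrite leq_exp2r.
  by case: (k) => [|[|[|[|]]]].
have e_ge : (0 < m)%N -> e = k.-1 by move=> /k_ge4; lia.
have e_ge0 : (k < 2 * e)%N by lia.
apply/negP; rewrite -ltnNge -(@ltn_exp2r _ _ 2) // expnMn -!expnM.
apply: (@leq_ltn_trans (2 ^ (k * w * 2) * (2 ^ (k * m * n.-1)))%N).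
  by rewrite leq_mul2l (mulnC n.-1) (expnM Q) (expnM 2 (k * m)) leq_exp2r ?Qsqr ?orbT //; lia.
rewrite -expnD ltn_exp2l //.
case: (n) n1 => [|[|n']] // _; rewrite wE /=.
have [m0|m0] := posnP m.
  rewrite m0; nia.
have := k_ge4 m0; rewrite (e_ge m0); case: (k) => // k' k'4 /=.
nia.
Qed.

(** A prime p dividing q and one element of X divides all of them. Dividing X by
    p then divides the n-th powers of the distances by p^n, while the
    congruence loses only the factor gcd(q, p^n), so that the hypotheses
    survive for a smaller q with no new primes. The maximum with 1 accounts for
    a descent that ends at q = 1, where two consecutive integers can remain. *)
Lemma power_congruent_size (n q : nat) (X : seq int) : (1 < n)%N -> (0 < q)%N ->
  uniq X -> {in X &, forall x y, (q %| x ^+ n - y ^+ n)%Z} ->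
  {in X &, forall x y, (`|x - y| ^ n <= q)%N} ->
  (size X <= n * maxn 1 (size (primes q)))%N.
Proof.
move=> n1; have [N] := ubnP q; elim: N q X => // N IH q X ltqN q0 uX congX diamX.
have [/hasP[p pq /hasP[x0 x0X px0]]|/hasPn coX] :=
  boolP (has (fun p => has (fun x => (p%:Z %| x)%Z) X) (primes q)); last first.
  have [q1|q1] := ltnP 1 q.
    have := @coprime_power_congruent_size n q X n1 q1 uX _ congX diamX.
    move=> H; apply: leq_trans (H _) _ => [p x /coX /hasPn pX xX|].
      exact: pX.
    by rewrite leq_mul2l leq_maxr orbT.
  have -> : q = 1%N by lia.
  apply: (@leq_trans 2); last by rewrite (leq_trans n1) // leq_pmulr // leq_maxl.
  have dist x y : x \in X -> y \in X -> (`|(x - y)%R| <= 1)%N.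
    move=> xX yX; rewrite -(@leq_exp2r _ _ n) ?exp1n; last by lia.
    by apply: leq_trans (diamX x y xX yX) q1.
  case: X {congX diamX coX} uX dist => [|a [|b [|c X]]] //= uX dist.
  move: uX; rewrite /= !inE !negb_or -!andbA => /and5P[ab ac _ bc _].
  have ba1 := dist a b; have ac1 := dist a c; have bc1 := dist b c.
  move: ba1 ac1 bc1; rewrite !inE !eqxx !orbT.
  by move=> /(_ isT isT) ? /(_ isT isT) ? /(_ isT isT) ?; lia.
have [pp _ pdvq] := and3P (etrans (esym (mem_primes p q)) pq).
have n0 : (0 < n)%N by lia.
have pX x : x \in X -> (p %| x)%Z.
  move=> xX; apply: (prime_dvdz_X (m := n) pp).
  rewrite (dvdz_congr (b := x0 ^+ n)) ?dvdz_exp //.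
  by apply: dvdz_trans (congX x x0 xX x0X); rewrite dvdzE.
have p0 : p%:Z != 0 by have := prime_gt0 pp; lia.
have XE x : x \in X -> x = (x %/ p)%Z * p by move=> /pX /divzK.
have pn0 : (0 < p ^ n)%N by rewrite expn_gt0 prime_gt0.
set g := gcdn q (p ^ n).
have g0 : (0 < g)%N by rewrite gcdn_gt0 q0.
have [q1 qE] := dvdnP (dvdn_gcdl q (p ^ n)).
have [h hE] := dvdnP (dvdn_gcdr q (p ^ n)).
rewrite -/g in qE hE.
have cop : coprime q1 h.
  rewrite /coprime -(eqn_pmul2r g0) muln_gcdl -qE -hE mul1n; exact: eqxx.
have q10 : (0 < q1)%N by move: q0; rewrite qE muln_gt0 => /andP[].
have g1 : (1 < g)%N.
  apply: leq_trans (prime_gt1 pp) _; apply: dvdn_leq => //.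
  by rewrite dvdn_gcd pdvq dvdn_exp.
have := @IH q1 [seq (x %/ p)%Z | x <- X].
rewrite size_map => H; apply: leq_trans (H _ q10 _ _ _) _.
- by apply: (@leq_trans q) => //; rewrite qE ltn_Pmulr.
- rewrite map_inj_in_uniq // => x y /XE {2}-> /XE {2}-> -> //.
- move=> _ _ /mapP[x xX ->] /mapP[y yX ->].
  have := congX x y xX yX; rewrite {1}(XE x xX) {1}(XE y yX) !exprMn -mulrBl.
  set D := _ - _; rewrite !dvdzE abszM abszX /= hE {1}qE mulnA dvdn_pmul2r //.
  by rewrite Gauss_dvdl.
- move=> _ _ /mapP[x xX ->] /mapP[y yX ->].
  have := diamX x y xX yX; rewrite {1}(XE x xX) {1}(XE y yX) -mulrBl.
  set D := _ - _; rewrite abszM expnMn /= => le.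
  rewrite -(leq_pmul2r pn0); apply: leq_trans le _.
  by rewrite {1}qE leq_mul2l dvdn_leq ?orbT // dvdn_gcdr.
rewrite leq_mul2l geq_max leq_maxl /= leq_max uniq_leq_size ?primes_uniq ?orbT //.
by move=> r; rewrite !mem_primes q0 q10 => /andP[-> /= rq]; rewrite qE dvdn_mulr.
Qed.

(** * Integer points of an interval *)

Lemma dist_le_itv_length (R : realType) (I : interval R) (x y : R) :
  x \in I -> y \in I -> ((x - y)%:E <= itv_length I)%E.
Proof.
case: I => a b; rewrite !itv_boundlr => /andP[ax xb] /andP[ay yb].
rewrite /itv_length /=.
have lea (z : R) : (a <= BLeft z)%O -> ((a : \bar R) <= z%:E)%E.
  case: a {ax ay} => [[]r|[]] //=; rewrite ?leNye //.
    by rewrite bnd_simp lee_fin // => /ltW.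
have leb (z : R) : (BRight z <= b)%O -> (z%:E <= (b : \bar R))%E.
  case: b {xb yb} => [[]r|[]] //=; rewrite ?leey //.
    by rewrite bnd_simp lee_fin // => /ltW.
have {}ax := lea _ ax; have {}ay := lea _ ay.
have {}xb := leb _ xb; have {}yb := leb _ yb.
case: ifPn => [_|]; first by rewrite EFinB leeB.
rewrite -leNgt => ba; rewrite EFinB sube_le0.
by apply: le_trans xb _; apply: le_trans ba _.
Qed.

Theorem theorem2p9 (R : realType) (n : nat) (hn : (2 <= n)%N) (d : int)
    (q : nat) (hq : (2 <= q)%N) (I : interval R)
    (hI : (itv_length I <= ((q%:R : R) `^ (n%:R^-1))%:E)%E) :
  finite_set (solutions n d q I) /\
  (#|` fset_set (solutions n d q I)|%fset <= n * omega q)%N.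
Proof.
have n0 : (0 < n)%N by apply: leq_trans hn.
have w1 : maxn 1 (size (primes q)) = omega q.
  apply/maxn_idPr; have : pdiv q \in primes q.
    by rewrite mem_primes pdiv_prime // pdiv_dvd (leq_trans _ hq).
  by case: (primes q).
have bound (X : seq int) : uniq X -> {in X, forall x, solutions n d q I x} ->
    (size X <= n * omega q)%N.
  move=> uX solX; rewrite -w1.
  apply: power_congruent_size => //; first by apply: leq_trans hq.
    move=> x y /solX[_ Px] /solX[_ Py]; rewrite -Py in Px.
    move/eqP: Px; rewrite eqz_mod_dvd /binom_poly !hornerE.
    by rewrite opprD addrACA subrr addr0.
  move=> x y /solX[Ix _] /solX[Iy _].
  have le u v : (u%:~R : R) \in I -> (v%:~R : R) \in I ->
      u%:~R - v%:~R <= (q%:R : R) `^ (n%:R^-1).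
    by move=> Iu Iv; rewrite -lee_fin; apply: le_trans hI; apply: dist_le_itv_length.
  have absle : (`|x - y|%N%:R : R) <= (q%:R : R) `^ (n%:R^-1).
    rewrite natr_absz intr_norm rmorphB /= ler_norml le // andbT.
    by rewrite lerNl opprB le.
  rewrite -(ler_nat R) natrX.
  have -> : q%:R = ((q%:R : R) `^ (n%:R^-1)) ^+ n.
    rewrite -powR_mulrn ?powR_ge0 // -powRrM mulVf ?powRr1 ?ler0n //.
    by rewrite pnatr_eq0 -lt0n.
  by rewrite lerXn2r // nnegrE ?powR_ge0.
have fin : finite_set (solutions n d q I).
  apply: contrapT => /(infinite_set_fset (n * omega q).+1)[B subB ltB].
  have := bound B (fset_uniq B) (fun x xB => subB x xB).
  by rewrite leqNgt ltB.
split=> //; apply: bound; first exact: fset_uniq.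
by move=> x; rewrite in_fset_set // => /set_mem.
Qed.
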